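(* Let $p$ be a prime and let $g\in\mathrm{PSL}(2,\mathbb{C}_p)$ be a $p$-adic Möbius map. (1) If $p\ge 3$, then $\rho_0(g,I)=M(g)$. (2) If $p=2$, then $2^{-1}M(g)\le\rho_0(g,I)\le 2M(g)$.
   Context: $\mathbb{C}_p$ is the completion of the algebraic closure of $\mathbb{Q}_p$, with $|p|=p^{-1}$. A $p$-adic Möbius map is an element of $\mathrm{PSL}(2,\mathbb{C}_p)=\mathrm{SL}(2,\mathbb{C}_p)/\{\pm I\}$, acting on $\mathbb{P}^1(\mathbb{C}_p)=\mathbb{C}_p\cup\{\infty\}$ by $z\mapsto\frac{az+b}{cz+d}$, $ad-bc=1$. Chordal metric: $\rho_v(z,w)=\frac{|z-w|}{\max\{1,|z|\}\max\{1,|w|\}}$ for $z,w\in\mathbb{C}_p$, $\rho_v(\infty,w)=\rho_v(w,\infty)=\frac1{\max\{1,|w|\}}$ for $w\in\mathbb{C}_p$, $\rho_v(\infty,\infty)=0$. For Möbius maps $g,h$, $\rho_0(g,h)=\sup_{z\in\mathbb{P}^1(\mathbb{C}_p)}\rho_v(g(z),h(z))$. Matrix norm: $\|(a_{ij})\|=\max_{i,j}|a_{ij}|$; $\|g\|$ is the norm of either lift of $g$ to $\mathrm{SL}(2,\mathbb{C}_p)$. Define $M(g)=\|g-g^{-1}\|/\|g\|$, where $g-g^{-1}$ is the difference of a lift of $g$ and the inverse matrix of that same lift; i.e. for $g(z)=\frac{az+b}{cz+d}$ with $ad-bc=1$, $M(g)=\frac{\max\{|a-d|,|2b|,|2c|\}}{\max\{|a|,|b|,|c|,|d|\}}$.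 *)

(* Defs.v *)
From HB Require Import structures.
From mathcomp Require Import all_boot all_order all_algebra.
From mathcomp Require Import generic_quotient.
From mathcomp Require Import boolp classical_sets reals.

Set Implicit Arguments.
Unset Strict Implicit.
Unset Printing Implicit Defensive.

Import Order.TTheory GRing.Theory Num.Theory.

Local Open Scope ring_scope.

Record is_ultrametric_abs (R : realType) (K : fieldType) (v : K -> R) : Prop :=
  IsUltrametricAbs {
    uabs_ge0 : forall x, 0 <= v x;
    uabs_eq0 : forall x, v x = 0 <-> x = 0;
    uabs_mul : forall x y, v (x * y) = v x * v y;
    uabs_add : forall x y, v (x + y) <= Num.max (v x) (v y) }.

Definition abs_complete (R : realType) (K : fieldType) (v : K -> R) : Prop :=
  forall u : nat -> K,
    (forall e : R, 0 < e -> exists N : nat, forall m n : nat,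
       (N <= m)%N -> (N <= n)%N -> v (u m - u n) < e) ->
    exists l : K, forall e : R, 0 < e -> exists N : nat, forall n : nat,
      (N <= n)%N -> v (u n - l) < e.

Record is_completion (R : realType) (K L : fieldType)
    (vK : K -> R) (vL : L -> R) (iota : {rmorphism K -> L}) : Prop :=
  IsCompletion {
    completion_abs : is_ultrametric_abs vL;
    completion_isometry : forall x : K, vL (iota x) = vK x;
    completion_dense : forall (y : L) (e : R), 0 < e ->
      exists x : K, vL (y - iota x) < e;
    completion_complete : abs_complete vL }.

Definition is_algebraic_closure (K L : fieldType) (iota : {rmorphism K -> L}) :
    Prop :=
  GRing.closed_field_axiom L /\ forall x : L, algebraicOver iota x.

(* |a / b|_p = p ^ (v_p b - v_p a), so that |p|_p = p^-1. *)
Definition padic_abs (R : realType) (p : nat) (x : rat) : R :=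
  if x == 0 then 0
  else p%:R ^+ logn p `|denq x|%N / p%:R ^+ logn p `|numq x|%N.

(* (K, v) is a model of C_p with its absolute value.  Q_p, its algebraic
   closure and C_p are determined up to isometric isomorphism by these clauses,
   the absolute value of Q_p having a unique extension to the closure. *)
Definition is_Cp (R : realType) (p : nat) (K : fieldType) (v : K -> R) : Prop :=
  exists (Qp : fieldType) (vQp : Qp -> R) (iQ : {rmorphism rat -> Qp})
         (Qpbar : fieldType) (vbar : Qpbar -> R)
         (iQp : {rmorphism Qp -> Qpbar}) (ibar : {rmorphism Qpbar -> K}),
    [/\ is_completion (@padic_abs R p) vQp iQ,
        is_algebraic_closure iQp,
        is_ultrametric_abs vbar,
        (forall x : Qp, vbar (iQp x) = vQp x)
      & is_completion vbar v ibar].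

Definition SL2 (K : fieldType) := {A : 'M[K]_2 | \det A == 1}.

Definition PSL2_rel (K : fieldType) (A B : SL2 K) : bool :=
  (val A == val B) || (val A == - val B).

Lemma PSL2_rel_refl (K : fieldType) : reflexive (@PSL2_rel K).
Proof. by move=> A; rewrite /PSL2_rel eqxx. Qed.

Lemma PSL2_rel_sym (K : fieldType) : symmetric (@PSL2_rel K).
Proof.
have h (A B : SL2 K) : PSL2_rel A B -> PSL2_rel B A.
  by rewrite /PSL2_rel => /orP[]/eqP->; rewrite ?opprK eqxx ?orbT.
by move=> A B; apply/idP/idP; exact: h.
Qed.

Lemma PSL2_rel_trans (K : fieldType) : transitive (@PSL2_rel K).
Proof.
move=> B A C; rewrite /PSL2_rel => /orP[]/eqP-> /orP[]/eqP->;
  by rewrite ?opprK eqxx ?orbT.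
Qed.

Canonical PSL2_equiv (K : fieldType) :=
  EquivRel (@PSL2_rel K) (@PSL2_rel_refl K) (@PSL2_rel_sym K)
    (@PSL2_rel_trans K).

Definition PSL2 (K : fieldType) := {eq_quot (PSL2_equiv K)}%qT.

Definition PSL2_of (K : fieldType) (A : SL2 K) : PSL2 K :=
  (\pi_({eq_quot (PSL2_equiv K)}) A)%qT.

(* A chosen lift to SL(2, K); what is defined through it below is independent
   of the choice, see the lemmas with suffix _of. *)
Definition lift_mx (K : fieldType) (g : PSL2 K) : 'M[K]_2 :=
  val (repr (g : {eq_quot (PSL2_equiv K)}%qT)).

Lemma det1_mx2 (K : fieldType) : \det (1%:M : 'M[K]_2) == 1.
Proof. by rewrite det1. Qed.

Definition PSL2_id (K : fieldType) : PSL2 K := 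
  PSL2_of (exist (fun A : 'M[K]_2 => \det A == 1) 1%:M (det1_mx2 K)).

(* P^1(K) = K with a point at infinity, which is None. *)
Definition P1 (K : fieldType) := option K.

Definition mobius_mx (K : fieldType) (A : 'M[K]_2) (z : P1 K) : P1 K :=
  let a := A 0 0 in let b := A 0 1 in let c := A 1 0 in let d := A 1 1 in
  match z with
  | Some x => if c * x + d == 0 then None else Some ((a * x + b) / (c * x + d))
  | None => if c == 0 then None else Some (a / c)
  end.

Definition mobius (K : fieldType) (g : PSL2 K) : P1 K -> P1 K :=
  mobius_mx (lift_mx g).

Definition chordal (R : realType) (K : fieldType) (v : K -> R)
    (z w : P1 K) : R :=
  match z, w with
  | Some x, Some y => v (x - y) / (Num.max 1 (v x) * Num.max 1 (v y))
  | Some x, None => (Num.max 1 (v x))^-1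
  | None, Some y => (Num.max 1 (v y))^-1
  | None, None => 0
  end.

Definition rho0 (R : realType) (K : fieldType) (v : K -> R) (g h : PSL2 K) : R :=
  sup (range (fun z : P1 K => chordal v (mobius g z) (mobius h z))).

Definition mx_max_norm (R : realType) (K : fieldType) (v : K -> R)
    (A : 'M[K]_2) : R :=
  \big[Num.max/0]_(i < 2) \big[Num.max/0]_(j < 2) v (A i j).

Definition mobius_norm (R : realType) (K : fieldType) (v : K -> R)
    (g : PSL2 K) : R :=
  mx_max_norm v (lift_mx g).

Definition mobius_M (R : realType) (K : fieldType) (v : K -> R) (g : PSL2 K) : R :=
  mx_max_norm v (lift_mx g - invmx (lift_mx g)) / mobius_norm v g.

Lemma uabsN (R : realType) (K : fieldType) (v : K -> R) :
  is_ultrametric_abs v -> forall x, v (- x) = v x.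
Proof.
move=> [v0 vz vM _] x.
have v1 : v 1 = 1.
  have nz : v 1 != 0 by apply/eqP => /vz/eqP; rewrite oner_eq0.
  by apply: (mulfI nz); rewrite -vM !mulr1.
have vN1 : v (-1) = 1.
  apply/eqP; rewrite -(@eqrXn2 _ 2) ?ler01 //.
  by rewrite expr1n expr2 -vM mulrNN mulr1 v1.
by rewrite -mulN1r vM vN1 mul1r.
Qed.

Lemma lift_mx_of (K : fieldType) (A : SL2 K) :
  lift_mx (PSL2_of A) = val A \/ lift_mx (PSL2_of A) = - val A.
Proof.
rewrite /lift_mx /PSL2_of.
have : (repr (\pi_({eq_quot (PSL2_equiv K)}) A) = A
         %[mod {eq_quot (PSL2_equiv K)}])%qT by rewrite reprK.
by move/eqmodP => /orP[]/eqP; [left|right].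
Qed.

Lemma mobius_of (K : fieldType) (A : SL2 K) (z : P1 K) :
  mobius (PSL2_of A) z = mobius_mx (val A) z.
Proof.
rewrite /mobius; case: (lift_mx_of A) => -> //.
case: z => [x|]; rewrite /mobius_mx !mxE ?oppr_eq0 ?invrN ?mulrNN //.
by rewrite !mulNr -!opprD oppr_eq0 invrN mulrNN.
Qed.

Lemma mx_max_normN (R : realType) (K : fieldType) (v : K -> R) (A : 'M[K]_2) :
  is_ultrametric_abs v -> mx_max_norm v (- A) = mx_max_norm v A.
Proof.
move=> hv; apply: eq_bigr => i _; apply: eq_bigr => j _.
by rewrite mxE uabsN.
Qed.

Lemma mobius_norm_of (R : realType) (K : fieldType) (v : K -> R) (A : SL2 K) :
  is_ultrametric_abs v -> mobius_norm v (PSL2_of A) = mx_max_norm v (val A).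
Proof.
by move=> hv; rewrite /mobius_norm; case: (lift_mx_of A) => ->; rewrite ?mx_max_normN.
Qed.

Lemma mobius_M_of (R : realType) (K : fieldType) (v : K -> R) (A : SL2 K) :
  is_ultrametric_abs v ->
  mobius_M v (PSL2_of A)
  = mx_max_norm v (val A - invmx (val A)) / mx_max_norm v (val A).
Proof.
move=> hv; rewrite /mobius_M mobius_norm_of //; case: (lift_mx_of A) => -> //.
have -> : invmx (- val A) = - invmx (val A).
  have AU : val A \in unitmx by rewrite unitmxE (eqP (valP A)) unitr1.
  by rewrite -scaleN1r invmxZ ?unitmxZ ?unitrN1 // invrN1 scaleN1r.
by rewrite -opprD mx_max_normN.
Qed.

Lemma chordal_le1 (R : realType) (K : fieldType) (v : K -> R) (z w : P1 K) :
  is_ultrametric_abs v -> chordal v z w <= 1.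
Proof.
move=> hv.
have m1 t : 1 <= Num.max 1 (v t) by rewrite le_max lexx.
have m0 t : 0 < Num.max 1 (v t) by apply: lt_le_trans (m1 t).
case: z w => [x|] [y|] //=; rewrite ?invf_le1 ?ler01 //.
rewrite ler_pdivrMr ?mulr_gt0 // mul1r.
apply: (le_trans (uabs_add hv _ _)); rewrite uabsN // ge_max; apply/andP; split.
  by rewrite -[leLHS]mulr1 ler_pM ?(uabs_ge0 hv) // le_max lexx orbT.
by rewrite -[leLHS]mul1r ler_pM ?(uabs_ge0 hv) // le_max lexx orbT.
Qed.

Lemma rho0_has_sup (R : realType) (K : fieldType) (v : K -> R) (g h : PSL2 K) :
  is_ultrametric_abs v ->
  has_sup (range (fun z : P1 K => chordal v (mobius g z) (mobius h z))).
Proof.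
move=> hv; split; first by exists (chordal v (mobius g None) (mobius h None)), None.
by exists 1 => _ [z _ <-]; exact: chordal_le1.
Qed.

(* Main.v *)
Require Import Defs.
From mathcomp Require Import all_boot all_order all_algebra.
From mathcomp Require Import reals.
From mathcomp Require Import generic_quotient classical_sets ring lra.

Set Implicit Arguments.
Unset Strict Implicit.
Unset Printing Implicit Defensive.

Import Order.TTheory GRing.Theory Num.Theory.
Local Open Scope ring_scope.

(** Write [[a, b], [c, d]] for a lift of g and N for its norm.  For every
    ultrametric absolute value, whatever the residue characteristic,
      rho0 g I = D / N,  where D = max (|a - d|, |b|, |c|);
    this is [rho0_id].  The absolute value of 2 enters only afterwards, when D
    is compared with max (|a - d|, |2b|, |2c|), the numerator of M(g): they are
    equal if |2| = 1, and D is the larger one, by a factor of at most 2, if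
    |2| = 1/2.

    In homogeneous coordinates, the distance from (x : y) to its image is
      |Q(x, y)| / (|(a x + b y, c x + d y)| |(x, y)|),
    with Q(x, y) = b y^2 + (a - d) x y - c x^2 and the max norm on vectors
    ([chordal_hom], [mobius_hom]).  Since vectors are stretched at most by N,
    evaluating at (1, 0), (0, 1) and (1, 1) recovers all three coefficients of
    Q, and so D <= N rho0 ([displacement_le_rho0]).  For the converse there is a
    dichotomy ([displacement_norm_dichotomy]).  Either N <= D, and the bound is
    the trivial rho0 <= 1; or N = 1, in which case g and its inverse both have
    norm 1, so that g preserves the norm of vectors and the bound is
    |Q(x, y)| <= D |(x, y)|^2. *)

(** * Ultrametric absolute values *)

Section Ultrametric.
Context (R : realType) (K : fieldType) (v : K -> R).
Hypothesis hv : is_ultrametric_abs v.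

Local Notation max := Num.max.

Lemma uabs0 : v 0 = 0. Proof. exact/(uabs_eq0 hv). Qed.

Lemma uabs_neq0 x : x != 0 -> v x != 0.
Proof. by apply: contra => /eqP/(uabs_eq0 hv)->. Qed.

Lemma uabs_gt0 x : x != 0 -> 0 < v x.
Proof. by move=> x0; rewrite lt_def uabs_neq0 ?(uabs_ge0 hv). Qed.

Lemma uabs1 : v 1 = 1.
Proof.
by apply: (mulfI (uabs_neq0 (oner_neq0 K))); rewrite -(uabs_mul hv) !mulr1.
Qed.

Lemma uabs_div x y : y != 0 -> v (x / y) = v x / v y.
Proof.
move=> y0; apply: (mulIf (uabs_neq0 y0)).
by rewrite -(uabs_mul hv) !divfK ?uabs_neq0.
Qed.

Lemma uabs_add_le x y m : v x <= m -> v y <= m -> v (x + y) <= m.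
Proof. by move=> xm ym; rewrite (le_trans (uabs_add hv _ _)) // ge_max xm. Qed.

Lemma uabs_sub_le x y m : v x <= m -> v y <= m -> v (x - y) <= m.
Proof. by move=> xm ym; rewrite uabs_add_le ?uabsN. Qed.

Lemma uabs_mul_le x y m n : v x <= m -> v y <= n -> v (x * y) <= m * n.
Proof. by move=> xm yn; rewrite (uabs_mul hv) ler_pM ?(uabs_ge0 hv). Qed.

Lemma uabs_sub_dominant x y : v y < v x -> v (x - y) = v x.
Proof.
move=> yx; apply/le_anti; rewrite uabs_sub_le ?(ltW yx) //=.
have := uabs_add hv (x - y) y; rewrite subrK le_max.
by rewrite [v x <= v y]leNgt yx orbF.
Qed.

(** * Homogeneous coordinates on the projective line *)

Definition vnorm (x y : K) : R := max (v x) (v y).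

Definition hom_point (x y : K) : P1 K := if y == 0 then None else Some (x / y).

Lemma hom_pointP (z : P1 K) :
  exists x y, (x != 0) || (y != 0) /\ z = hom_point x y.
Proof.
case: z => [x|]; [exists x, 1 | exists 1, 0]; rewrite /hom_point.
  by rewrite oner_eq0 orbT divr1.
by rewrite oner_eq0 eqxx.
Qed.

Lemma vnorm_gt0 x y : (0 < vnorm x y) = (x != 0) || (y != 0).
Proof.
rewrite /vnorm lt_max; have h t : (0 < v t) = (t != 0).
  apply/idP/idP; last exact: uabs_gt0.
  by apply: contraTneq => ->; rewrite uabs0 ltxx.
by rewrite !h.
Qed.

Lemma vnorm_affine x y : y != 0 -> max 1 (v (x / y)) = vnorm x y / v y.
Proof.
move=> y0; rewrite uabs_div // /vnorm maxC.
by rewrite maxr_pMl ?invr_ge0 ?(uabs_ge0 hv) // divff ?uabs_neq0.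
Qed.

Lemma vnorm_infty x : vnorm x 0 = v x.
Proof. by rewrite /vnorm uabs0; apply/max_idPl/(uabs_ge0 hv). Qed.

(** The chordal metric is the area form on normalized vectors, which treats the
    point at infinity like any other. *)
Lemma chordal_hom x y x' y' :
    (x != 0) || (y != 0) -> (x' != 0) || (y' != 0) ->
  chordal v (hom_point x y) (hom_point x' y')
  = v (x * y' - x' * y) / (vnorm x y * vnorm x' y').
Proof.
have aff (s t s' : K) : t != 0 -> s' != 0 ->
    (max 1 (v (s / t)))^-1 = v (s' * t) / (v s' * vnorm s t).
  move=> t0 s0; rewrite vnorm_affine // invf_div (uabs_mul hv).
  by rewrite -mulf_div divff ?mul1r ?uabs_neq0.
rewrite /hom_point; have [->|y0] := eqVneq y 0; have [->|y'0] := eqVneq y' 0;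
  rewrite ?eqxx ?orbF /= => n n'.
- by rewrite !mulr0 subrr uabs0 mul0r.
- by rewrite mulr0 subr0 vnorm_infty; apply: aff.
- by rewrite mulr0 sub0r uabsN // vnorm_infty [vnorm x y * _]mulrC; apply: aff.
have -> : x / y - x' / y' = (x * y' - x' * y) / (y * y') by field; apply/andP.
rewrite !vnorm_affine // uabs_div ?mulf_neq0 // (uabs_mul hv).
have := vnorm_gt0 x y; have := vnorm_gt0 x' y'; rewrite y0 y'0 !orbT.
move=> /lt0r_neq0 m0 /lt0r_neq0 m1.
by field; rewrite m0 m1 !uabs_neq0.
Qed.

End Ultrametric.

(** * Moebius maps with a given lift *)

Lemma det_mx2 (K : fieldType) (A : 'M[K]_2) :
  \det A = A 0 0 * A 1 1 - A 0 1 * A 1 0.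
Proof.
rewrite (expand_det_row _ 0) !big_ord_recl big_ord0 addr0 /cofactor !det_mx11.
rewrite !mxE /= expr0 expr1 mul1r mulN1r mulrN.
by congr (A _ _ * A _ _ - A _ _ * A _ _); apply: val_inj.
Qed.

Lemma mx_max_norm2E (R : realType) (K : fieldType) (v : K -> R) (A : 'M[K]_2) :
    is_ultrametric_abs v ->
  mx_max_norm v A
  = Num.max (Num.max (v (A 0 0)) (v (A 0 1))) (Num.max (v (A 1 0)) (v (A 1 1))).
Proof.
move=> hv; rewrite /mx_max_norm !big_ord_recl !big_ord0.
have -> : lift 0 0 = 1 :> 'I_2 by apply: val_inj.
by rewrite ![Num.max _ 0](max_idPl _) ?le_max ?(uabs_ge0 hv) ?orbT.
Qed.

Section Lift.
Context (R : realType) (K : fieldType) (v : K -> R).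
Hypothesis hv : is_ultrametric_abs v.
Context (A : SL2 K).

Local Notation max := Num.max.
Local Notation a := (val A 0 0).
Local Notation b := (val A 0 1).
Local Notation c := (val A 1 0).
Local Notation d := (val A 1 1).
Local Notation N := (mx_max_norm v (val A)).

Lemma SL2_det : a * d - b * c = 1.
Proof. by rewrite -det_mx2 (eqP (valP A)). Qed.

Lemma entries_le_norm : [/\ v a <= N, v b <= N, v c <= N & v d <= N].
Proof. by rewrite mx_max_norm2E // !le_max !lexx !orbT. Qed.

Lemma vnorm_image_le x y :
  vnorm v (a * x + b * y) (c * x + d * y) <= N * vnorm v x y.
Proof.
have [ha hb hc hd] := entries_le_norm.
by rewrite {1}/vnorm ge_max !(uabs_add_le hv) ?uabs_mul_le // le_max lexx ?orbT.
Qed.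

(** The inverse matrix has the same entries up to sign, hence the same norm. *)
Lemma vnorm_le_image x y :
  vnorm v x y <= N * vnorm v (a * x + b * y) (c * x + d * y).
Proof.
have [ha hb hc hd] := entries_le_norm; have hdet := SL2_det.
set x' := a * x + b * y; set y' := c * x + d * y.
have -> : x = d * x' - b * y'.
  by rewrite -[LHS]mul1r -[in LHS]hdet /x' /y'; ring.
have -> : y = a * y' - c * x'.
  by rewrite -[LHS]mul1r -[in LHS]hdet /x' /y'; ring.
rewrite {1}/vnorm ge_max.
by rewrite !(uabs_sub_le hv) ?uabs_mul_le // le_max lexx ?orbT.
Qed.

Lemma norm_ge0 : 0 <= N.
Proof. by case: entries_le_norm => /(le_trans (uabs_ge0 hv _)). Qed.

Lemma image_neq0 x y :
  (x != 0) || (y != 0) -> (a * x + b * y != 0) || (c * x + d * y != 0).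
Proof.
rewrite -!(vnorm_gt0 hv) => h; have := lt_le_trans h (vnorm_le_image x y).
by apply: contraTT; rewrite -!leNgt => h0; rewrite mulr_ge0_le0 ?norm_ge0.
Qed.

Lemma mobius_hom x y : (x != 0) || (y != 0) ->
  mobius_mx (val A) (hom_point x y)
  = hom_point (a * x + b * y) (c * x + d * y).
Proof.
rewrite /mobius_mx /hom_point; have [->|y0] := eqVneq y 0;
  rewrite /= ?orbF => x0.
  rewrite !mulr0 !addr0 mulf_eq0 (negPf x0) orbF.
  by case: eqP => // _; rewrite -mulf_div divff ?mulr1.
have -> : c * (x / y) + d = (c * x + d * y) / y by field.
have -> : a * (x / y) + b = (a * x + b * y) / y by field.
rewrite mulf_eq0 invr_eq0 (negPf y0) orbF; case: eqP => // /eqP h.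
by congr Some; field; rewrite h y0.
Qed.

(** * The distance from a map to the identity *)

Definition displacement : R := max (v (a - d)) (max (v b) (v c)).

(** The binary quadratic form whose zeros in P^1 are the fixed points. *)
Definition fixed_form (x y : K) : K :=
  b * (y * y) + (a - d) * (x * y) - c * (x * x).

Lemma chordal_fixed_form x y : (x != 0) || (y != 0) ->
  chordal v (mobius (PSL2_of A) (hom_point x y))
            (mobius (PSL2_id K) (hom_point x y))
  = v (fixed_form x y)
    / (vnorm v (a * x + b * y) (c * x + d * y) * vnorm v x y).
Proof.
move=> n; have -> : mobius (PSL2_id K) (hom_point x y) = hom_point x y.
  rewrite /PSL2_id mobius_of /= /hom_point; case: ifP => _ /=.
    by rewrite mxE eqxx.
  by rewrite !mxE /= mul0r add0r oner_eq0 mul1r addr0 divr1.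
rewrite mobius_of mobius_hom // chordal_hom ?image_neq0 //.
by congr (v _ / _); rewrite /fixed_form; ring.
Qed.

Lemma norm_gt0 : 0 < N.
Proof.
rewrite lt_def norm_ge0 andbT; apply: contraTneq (vnorm_le_image 1 0) => ->.
by rewrite mul0r -ltNge (vnorm_gt0 hv) oner_eq0.
Qed.

Lemma fixed_form_le_rho0 x y : vnorm v x y = 1 ->
  v (fixed_form x y) <= rho0 v (PSL2_of A) (PSL2_id K) * N.
Proof.
move=> xy1; have n : (x != 0) || (y != 0) by rewrite -(vnorm_gt0 hv) xy1.
have rho : chordal v (mobius (PSL2_of A) (hom_point x y))
    (mobius (PSL2_id K) (hom_point x y)) <= rho0 v (PSL2_of A) (PSL2_id K).
  by apply: (sup_upper_bound (rho0_has_sup _ _ hv)); exists (hom_point x y).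
have g0 : 0 < vnorm v (a * x + b * y) (c * x + d * y).
  by rewrite (vnorm_gt0 hv) image_neq0.
rewrite chordal_fixed_form // xy1 mulr1 in rho.
have rho_ge0 := le_trans (divr_ge0 (uabs_ge0 hv _) (ltW g0)) rho.
rewrite ler_pdivrMr // in rho; apply: (le_trans rho); apply: ler_wpM2l => //.
by have := vnorm_image_le x y; rewrite xy1 mulr1.
Qed.

(** The values of the form at (1, 0), (0, 1) and (1, 1) determine its
    coefficients by additions and subtractions alone, so no constant is lost. *)
Lemma displacement_le_rho0 :
  displacement <= rho0 v (PSL2_of A) (PSL2_id K) * N.
Proof.
have v0 := uabs0 hv; have v1 := uabs1 hv.
have h10 := @fixed_form_le_rho0 1 0; have h01 := @fixed_form_le_rho0 0 1.
have h11 := @fixed_form_le_rho0 1 1.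
rewrite /vnorm !v0 !v1 maxxx (max_idPl ler01) (max_idPr ler01) in h10 h01 h11.
have {h10} hc := h10 erefl; have {h01} hb := h01 erefl; have {}h11 := h11 erefl.
rewrite /fixed_form !(mulr0, mul0r, mulr1, add0r, addr0, subr0) in hb hc h11.
rewrite uabsN // in hc.
rewrite /displacement !ge_max hb hc !andbT.
have -> : a - d = (b + (a - d) - c) - (b - c) by ring.
by apply: (uabs_sub_le hv) => //; exact: (uabs_sub_le hv).
Qed.

(** If D < N, then b and c are smaller than N and |a| = |d| = N, so that a d
    dominates the determinant and 1 = |a d - b c| = N^2. *)
Lemma displacement_norm_dichotomy : N <= displacement \/ N = 1.
Proof.
have [|DN] := leP N displacement; [by left | right].
move: DN; rewrite /displacement !gt_max => /and3P[adN bN cN].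
have [aN dN] : v a = N /\ v d = N.
  have [ha _ _ hd] := entries_le_norm.
  have : (N <= v a) || (N <= v d).
    apply: contraT; rewrite negb_or -!ltNge => /andP[aN dN].
    suff : N < N by rewrite ltxx.
    by rewrite {1}mx_max_norm2E // !gt_max aN bN cN dN.
  case/orP => h.
    have aN : v a = N by apply/le_anti; rewrite ha h.
    by split=> //; rewrite -aN -[d](subKr a) (uabs_sub_dominant hv) // aN.
  have dN : v d = N by apply/le_anti; rewrite hd h.
  split=> //; rewrite -dN -[a](subKr d) (uabs_sub_dominant hv) //.
  by rewrite -(uabsN hv) opprB dN.
have N0 := norm_gt0.
have : v (a * d - b * c) = N * N.
  have ltbc : v (b * c) < v (a * d).
    by rewrite !(uabs_mul hv) aN dN ltr_pM ?(uabs_ge0 hv).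
  by rewrite (uabs_sub_dominant hv ltbc) (uabs_mul hv) aN dN.
rewrite SL2_det uabs1 // => /esym/eqP; rewrite -expr2 sqrp_eq1 ?(ltW N0) //.
by move/eqP.
Qed.

Lemma fixed_form_le x y :
  v (fixed_form x y) <= displacement * (vnorm v x y * vnorm v x y).
Proof.
have [hx hy] : v x <= vnorm v x y /\ v y <= vnorm v x y.
  by rewrite !le_max !lexx orbT.
have [hQ hb hc] : [/\ v (a - d) <= displacement, v b <= displacement
                   & v c <= displacement].
  by rewrite !le_max !lexx !orbT.
by rewrite (uabs_sub_le hv) ?(uabs_add_le hv) ?(uabs_mul_le hv).
Qed.

(** When N <= D the bound is that of the metric by 1; when N = 1 the vector
    (x, y) is no longer than its image, so the quotient of the fixed form by the
    two norms is at most D. *)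
Lemma rho0_id :
  rho0 v (PSL2_of A) (PSL2_id K) = displacement / N.
Proof.
have N0 := norm_gt0.
apply/le_anti/andP; split; last by rewrite ler_pdivrMr // displacement_le_rho0.
have [ne _] := rho0_has_sup (PSL2_of A) (PSL2_id K) hv.
apply: (ge_sup ne) => _ [z _ <-].
have [ND|N1] := displacement_norm_dichotomy.
  by apply: le_trans (chordal_le1 _ _ hv) _; rewrite ler_pdivlMr ?mul1r.
have [x [y [n ->]]] := hom_pointP z; rewrite chordal_fixed_form // N1 divr1.
have xy0 : 0 < vnorm v x y by rewrite vnorm_gt0.
have g0 : 0 < vnorm v (a * x + b * y) (c * x + d * y).
  by rewrite vnorm_gt0 ?image_neq0.
rewrite ler_pdivrMr ?mulr_gt0 // (le_trans (fixed_form_le x y)) //.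
apply: ler_wpM2l; first by rewrite /displacement le_max (uabs_ge0 hv).
by rewrite ler_pM2r //; have := vnorm_le_image x y; rewrite N1 mul1r.
Qed.

(** The matrix inverse is the adjugate: exchange the diagonal, negate the
    rest.  In ['I_2], [1 - i] is the index other than [i]. *)
Lemma invmx_SL2 (i j : 'I_2) :
  invmx (val A) i j = if i == j then val A (1 - i) (1 - j) else - val A i j.
Proof.
pose B := \matrix_(i, j) if i == j then val A (1 - i) (1 - j) else - val A i j.
suff AB : val A *m B = 1%:M.
  have AU : val A \in unitmx by rewrite unitmxE (eqP (valP A)) unitr1.
  by rewrite -[invmx _]mulmx1 -AB mulKmx // mxE.
have l1 : lift 0 0 = 1 :> 'I_2 by apply: val_inj.
have s0 : 1 - 0 = 1 :> 'I_2 by apply: val_inj.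
have s1 : 1 - 1 = 0 :> 'I_2 by apply: val_inj.
have hdet := SL2_det.
have cases (k : 'I_2) : k = 0 \/ k = 1.
  by case: k => [[|[]] // h]; [left|right]; apply: val_inj.
apply/matrixP => k l; rewrite !mxE !big_ord_recl big_ord0 !mxE l1 addr0.
by case: (cases k) (cases l) => -> [] ->; rewrite ?s0 ?s1 /= ?mulr1n;
  first [ring | apply: etrans hdet; ring].
Qed.

Lemma mobius_ME :
  mobius_M v (PSL2_of A)
  = max (v (a - d)) (max (v 2 * v b) (v 2 * v c)) / N.
Proof.
rewrite mobius_M_of // [X in X / _]mx_max_norm2E // !mxE !invmx_SL2 /=.
have s0 : 1 - 0 = 1 :> 'I_2 by apply: val_inj.
have s1 : 1 - 1 = 0 :> 'I_2 by apply: val_inj.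
have h2 x : v (x - - x) = v 2 * v x.
  by rewrite opprK -(uabs_mul hv) mulr_natl mulr2n.
rewrite s0 s1 !h2 -[v (d - a)](uabsN hv) opprB; congr (_ / _).
by rewrite [max (v 2 * v c) _]maxC maxACA maxxx.
Qed.

End Lift.

(** * The absolute value of 2 in C_p *)

Lemma Cp_abs (R : realType) (p : nat) (Cp : fieldType) (v : Cp -> R) :
  is_Cp p v -> is_ultrametric_abs v.
Proof. by case=> [Qp [vQ [iQ [Qb [vb [iQp [ib [_ _ _ _ []]]]]]]]]. Qed.

Lemma Cp_abs_nat (R : realType) (p : nat) (Cp : fieldType) (v : Cp -> R) n :
  is_Cp p v -> v n%:R = padic_abs R p n%:R.
Proof.
case=> [Qp [vQ [iQ [Qb [vb [iQp [ib [[_ isoQ _ _] _ _ isob [_ iso _ _]]]]]]]]].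
by rewrite -(rmorph_nat ib) iso -(rmorph_nat iQp) isob -(rmorph_nat iQ) isoQ.
Qed.

Lemma padic_abs2 (R : realType) (p : nat) :
  prime p -> padic_abs R p 2 = if p == 2%N then 2^-1 else 1.
Proof.
move=> hp; have -> : 2 = 2%:Z%:~R :> rat by [].
rewrite /padic_abs numq_int denq_int intr_eq0 /=.
rewrite logn1 expr0 div1r lognE hp /= dvdn_prime2 //.
by case: eqP => [->|_] //=; rewrite invr1.
Qed.

Theorem theorem1p5 (R : realType) (p : nat) (hp : prime p)
    (Cp : fieldType) (v : Cp -> R) (hCp : is_Cp p v) (g : PSL2 Cp) :
  ((3 <= p)%N -> rho0 v g (PSL2_id Cp) = mobius_M v g) /\
  (p = 2%N ->
     2^-1 * mobius_M v g <= rho0 v g (PSL2_id Cp) <= 2 * mobius_M v g).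
Proof.
have hv := Cp_abs hCp; have v2 := Cp_abs_nat 2 hCp.
rewrite padic_abs2 // in v2.
pose A : SL2 Cp := repr (g : {eq_quot (PSL2_equiv Cp)}%qT).
have -> : g = PSL2_of A by rewrite /PSL2_of /A reprK.
rewrite rho0_id // mobius_ME // v2 /displacement.
split=> [p3 | ->].
  by rewrite gtn_eqF // !mul1r.
rewrite eqxx; have N0 := norm_gt0 hv A.
rewrite !mulrA !ler_pM2r ?invr_gt0 //.
have : 0 <= v (val A 0 0 - val A 1 1) by exact: uabs_ge0.
have : 0 <= v (val A 0 1) by exact: uabs_ge0.
have : 0 <= v (val A 1 0) by exact: uabs_ge0.
move: (v _) (v _) (v _) => r s t r0 s0 t0.
rewrite -maxr_pMr ?invr_ge0 //.
have : 0 <= Num.max s t by rewrite le_max s0.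
move: (Num.max s t) => m m0.
rewrite !maxr_pMr ?invr_ge0 // mulVKf ?pnatr_eq0 //.
apply/andP; split; rewrite ge_max !le_max; apply/andP; split; apply/orP.
- by left; lra.
- by right; lra.
- by left; lra.
- by right.
Qed.
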